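(* Let $T$ be a $(1,D)$-quasiconformal tree with set of branch points $B$ and set of leaves $L$, and let $\overline{L}$ be the closure of $L$ in $T$. Then the subset $[B\cup\overline{L}]=\{[x]\,:\,x\in B\cup\overline{L}\}$ of the metric quotient $T/\overline{L}$ is $\frac{1}{8D^3}$-uniformly disconnected.
   Context: A metric space $T$ is a tree if it is compact, connected, locally connected, and every pair of distinct points of $T$ forms the endpoints of a unique Jordan arc (homeomorphic image of $[0,1]$) in $T$. A leaf of $T$ is a point $p\in T$ such that $T\setminus\{p\}$ is connected; a branch point of $T$ is a point $p\in T$ such that $T\setminus\{p\}$ has at least three connected components. A metric space is $C$-bounded turning ($C\ge1$) if any two points $u,v$ lie in a compact connected set $E$ with $\mathrm{diam}(E)\le C\,d(u,v)$. It is $D$-doubling if every closed ball of radius $r$ can be covered by at most $D$ closed balls of radius $r/2$. A $(C,D)$-quasiconformal tree is a tree that is $C$-bounded turning and $D$-doubling. Metric quotient: for a metric space $(X,d)$ and a closed subset $E\subset X$, $X/E$ is the set of equivalence classes of the relation $x\sim y$ iff $x=y$ or $x,y\in E$, with the metric $\rho([a],[b])=\min\{d(a,b),\,d(a,E)+d(b,E)\}$. For $\alpha\in(0,1]$, a finite sequence $x_0,\dots,x_m$ in a metric space is a relative $\alpha$-chain if $d(x_i,x_{i+1})\le\alpha\,d(x_0,x_m)$ for all $i<m$; it is nondegenerate if $x_0\ne x_m$. A metric space is $\alpha$-uniformly disconnected if it contains no nondegenerate relative $\alpha$-chain. *)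

(* Defs.v *)
From HB Require Import structures.
From mathcomp Require Import all_boot all_order all_algebra.
From mathcomp Require Import all_classical all_reals ereal topology normedtype.

Set Implicit Arguments.
Unset Strict Implicit.
Unset Printing Implicit Defensive.

Import Order.TTheory GRing.Theory Num.Theory.
Import numFieldNormedType.Exports.

Local Open Scope classical_set_scope.
Local Open Scope ring_scope.

Section trees.
Context {R : realType}.
Implicit Type T : metricType R.

Definition locally_connected (T : topologicalType) : Prop :=
  forall (x : T) (U : set T), nbhs x U ->
    exists V : set T, [/\ open V, connected V, V x & V `<=` U].

(* f is a homeomorphism from A onto B with inverse g; the values of f outside
   A and of g outside B are irrelevant. *)
Definition homeomorphism_on (X Y : topologicalType) (A : set X) (B : set Y)
    (f : X -> Y) (g : Y -> X) : Prop :=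
  [/\ set_fun A B f, set_fun B A g,
      {in A, cancel f g} & {in B, cancel g f}] /\
  ({within A, continuous f} /\ {within B, continuous g}).

Definition jordan_arc (T : topologicalType) (u v : T) (J : set T) : Prop :=
  exists (f : R -> T) (g : T -> R),
    [/\ homeomorphism_on (`[0, 1] : set R) J f g, f 0 = u & f 1 = v].

Definition is_tree T : Prop :=
  [/\ compact [set: T], connected [set: T], locally_connected T &
      forall u v : T, u <> v -> exists! J : set T, jordan_arc u v J].

Definition components (T : topologicalType) (A : set T) : set (set T) :=
  connected_component A @` A.

Definition leaves T : set T := [set p | connected (~` [set p])].

Definition branch_points T : set T :=
  [set p | (`I_3 #<= components (~` [set p]))%card].

Definition diam T (E : set T) : \bar R :=
  ereal_sup [set (mdist x y)%:E | x in E & y in E].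

Definition bounded_turning T (C : R) : Prop :=
  forall u v : T, exists E : set T,
    [/\ compact E, connected E, E u, E v & (diam E <= (C * mdist u v)%:E)%E].

(* The library's closed_ball is the closure of an open ball, which may be
   smaller. *)
Definition cball T (x : T) (r : R) : set T := [set y | mdist x y <= r].

Definition doubling T (D : R) : Prop :=
  forall (x : T) (r : R), 0 < r -> exists s : seq T,
    (size s)%:R <= D /\ cball x r `<=` \bigcup_(y in [set` s]) cball y (r / 2).

Definition quasiconformal_tree T (C D : R) : Prop :=
  [/\ is_tree T, bounded_turning T C & doubling T D].

Definition relative_chain T (a : R) (m : nat) (x : nat -> T) : Prop :=
  forall i, (i < m)%N -> mdist (x i) (x i.+1) <= a * mdist (x 0%N) (x m).

Definition uniformly_disconnected T (a : R) (A : set T) : Prop :=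
  ~ exists (m : nat) (x : nat -> T),
      [/\ forall i, (i <= m)%N -> A (x i), x 0%N <> x m & relative_chain a m x].

End trees.

Arguments leaves {R} T.
Arguments branch_points {R} T.

Section metric_quotient.
Context {R : realType} {T : metricType R}.
Implicit Types (E : set T) (x y z : T).

(* Equal to +oo when E is empty. *)
Definition dist_set E x : \bar R := ereal_inf [set (mdist x e)%:E | e in E].

Definition quotient_dist E x y : R :=
  fine (mine (mdist x y)%:E (dist_set E x + dist_set E y)%E).

Definition quotient_rel E x y : bool := `[< x = y \/ E x /\ E y >].

Lemma quotient_rel_refl E : reflexive (quotient_rel E).
Proof. by move=> x; apply/asboolP; left. Qed.

Lemma quotient_rel_sym E : symmetric (quotient_rel E).
Proof.
move=> x y; apply/asboolP/asboolP => -[->|[Ex Ey]]; by [left | right].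
Qed.

Lemma quotient_rel_trans E : transitive (quotient_rel E).
Proof.
move=> y x z /asboolP[->//|[Ex Ey]] /asboolP[<-|[_ Ez]];
  by apply/asboolP; right.
Qed.

Canonical quotient_equiv E : equiv_rel T :=
  EquivRel (quotient_rel E) (@quotient_rel_refl E) (@quotient_rel_sym E)
    (@quotient_rel_trans E).

Definition metric_quotient E (cE : closed E) : Type :=
  {eq_quot (quotient_equiv E)}%qT.

Lemma dist_set_ge0 E x : (0 <= dist_set E x)%E.
Proof.
by apply: le_ereal_inf_tmp => _ [e _ <-]; rewrite lee_fin mdist_ge0.
Qed.

Lemma dist_set_triangle E x y :
  (dist_set E x <= (mdist x y)%:E + dist_set E y)%E.
Proof.
rewrite -leeBlDl//; apply: le_ereal_inf_tmp => _ [e Ee <-].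
rewrite leeBlDl// -EFinD.
apply: (@le_trans _ _ (mdist x e)%:E); last by rewrite lee_fin metric_triangle.
by apply: ereal_inf_lbound; exists e.
Qed.

Lemma dist_set_in E x : E x -> dist_set E x = 0%E.
Proof.
move=> Ex; apply/eqP; rewrite eq_le dist_set_ge0 andbT.
by apply: ereal_inf_lbound; exists x => //; rewrite mdistxx.
Qed.

Lemma dist_set_eq0 E x : closed E -> dist_set E x = 0%E -> E x.
Proof.
move=> cE x0; apply: cE => A /nbhs_ballP[e /= e0 xA].
have : (dist_set E x < e%:E)%E by rewrite x0 lte_fin.
move=> /ereal_inf_lt[_ [z Ez <-]]; rewrite lte_fin => xz.
by exists z; split => //; apply: xA; rewrite ballEmdist.
Qed.

Lemma quotient_distE E x y : (quotient_dist E x y)%:E =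
  mine (mdist x y)%:E (dist_set E x + dist_set E y)%E.
Proof.
rewrite fineK// ge0_fin_numE; last first.
  by rewrite le_min lee_fin mdist_ge0 adde_ge0// dist_set_ge0.
by rewrite gt_min ltry.
Qed.

Lemma quotient_distxx E x : quotient_dist E x x = 0.
Proof.
apply: EFin_inj; rewrite quotient_distE mdistxx; apply/min_idPl.
by rewrite adde_ge0// dist_set_ge0.
Qed.

Lemma quotient_dist_sym E x y : quotient_dist E x y = quotient_dist E y x.
Proof. by rewrite /quotient_dist metric_sym addeC. Qed.

Lemma quotient_dist_triangle E y x z :
  quotient_dist E x z <= quotient_dist E x y + quotient_dist E y z.
Proof.
rewrite -lee_fin EFinD !quotient_distE.
have dt := dist_set_triangle; have d0 := dist_set_ge0.
have [_|_] := leP (mdist x y)%:E; have [_|_] := leP (mdist y z)%:E.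
- by rewrite ge_min -EFinD lee_fin metric_triangle.
- rewrite ge_min; apply/orP; right.
  by rewrite addeA leeD2r.
- rewrite ge_min; apply/orP; right.
  by rewrite -addeA leeD2l// addeC metric_sym.
- rewrite ge_min; apply/orP; right.
  by rewrite leeD// ?leeDl// ?leeDr.
Qed.

Lemma quotient_dist_eq0 E x y : closed E ->
  quotient_dist E x y = 0 -> quotient_rel E x y.
Proof.
move=> cE q0; have := congr1 (@EFin R) q0; rewrite quotient_distE {q0}.
have [_ xy0|_ xy0] := leP (mdist x y)%:E; apply/asboolP.
  by left; apply: mdist_positivity; exact: EFin_inj xy0.
have /eqP := xy0; rewrite padde_eq0 ?dist_set_ge0// => /andP[/eqP x0 /eqP y0].
by right; split; exact: dist_set_eq0.
Qed.

Lemma quotient_dist_rel E x y z : quotient_rel E x y ->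
  quotient_dist E x z = quotient_dist E y z.
Proof.
move=> /asboolP[->//|[Ex Ey]]; apply/eqP.
have xy0 : quotient_dist E x y = 0.
  apply: EFin_inj; rewrite quotient_distE !dist_set_in// adde0.
  by apply/min_idPr; rewrite lee_fin mdist_ge0.
rewrite eq_le -[leRHS]add0r -{1}xy0 quotient_dist_triangle.
by rewrite -[leRHS]add0r -xy0 (quotient_dist_sym E x y) quotient_dist_triangle.
Qed.

End metric_quotient.

Section metric_quotient_instance.
Context {R : realType} {T : metricType R} {E : set T} (cE : closed E).

HB.instance Definition _ := Choice.on (metric_quotient cE).

Definition quotient_class (x : T) : metric_quotient cE :=
  (\pi_({eq_quot (quotient_equiv E)}) x)%qT.

Let repr_class (a : metric_quotient cE) : T :=
  @repr _ {eq_quot (quotient_equiv E)}%qT a.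

Lemma quotient_classP x y :
  quotient_class x = quotient_class y <-> x = y \/ E x /\ E y.
Proof.
by split => [/eqmodP/asboolP|xy]; last exact/eqmodP/asboolP.
Qed.

Let repr_classK a : quotient_class (repr_class a) = a.
Proof. exact: reprK. Qed.

Let mdistq (a b : metric_quotient cE) : R :=
  quotient_dist E (repr_class a) (repr_class b).

Let mdistqxx a : mdistq a a = 0.
Proof. exact: quotient_distxx. Qed.

Let mdistq_positivity a b : mdistq a b = 0 -> a = b.
Proof.
move=> /(quotient_dist_eq0 cE)/asboolP ab.
by rewrite -(repr_classK a) -(repr_classK b); exact/quotient_classP.
Qed.

Let mdistq_sym a b : mdistq a b = mdistq b a.
Proof. exact: quotient_dist_sym. Qed.

Let mdistq_triangle b a c : mdistq a c <= mdistq a b + mdistq b c.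
Proof. exact: quotient_dist_triangle. Qed.

HB.instance Definition _ := @isMetric.Build R (metric_quotient cE) mdistq
  mdistqxx mdistq_positivity mdistq_sym mdistq_triangle.

Lemma mdist_quotient_class x y :
  mdist (quotient_class x) (quotient_class y) = quotient_dist E x y.
Proof.
have qr z : quotient_rel E (repr_class (quotient_class z)) z.
  by apply/asboolP/quotient_classP; exact: repr_classK.
rewrite [LHS](quotient_dist_rel _ (qr x)) quotient_dist_sym.
by rewrite (quotient_dist_rel _ (qr y)) quotient_dist_sym.
Qed.

End metric_quotient_instance.

(* Main.v *)
(** Since T is 1-bounded turning, a point p separating a from b satisfies
    d(a,p), d(p,b) <= d(a,b).  Let r be the quotient distance of the endpoints
    of a relative chain and eps = r/(8D^3); one endpoint, say x_0, is at
    distance at least r/2 from the leaves.  As long as the chain stays within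
    h = r/4 of x_0, it consists of branch points at distance at least h from
    the leaves, and both distances agree there.  Shorten this part until no
    step can be skipped.  At each of its points x_i choose a component C_i of
    the complement of x_i avoiding both ends; by minimality C_i avoids all x_j,
    so the C_i are pairwise disjoint.  Each C_i contains a leaf, hence a point
    z_i at distance h from x_i, and the z_i are h-separated in a ball of radius
    2h, so there are at most D^3 of them.  Hence the ends of this part are at
    distance at most (D^3 - 1) eps = r/8 - eps, too little for the next step to
    leave the ball of radius r/4 about x_0. *)

Require Import Defs.
From HB Require Import structures.
From mathcomp Require Import all_boot all_order all_algebra.
From mathcomp Require Import all_classical all_reals ereal topology normedtype.
From mathcomp Require Import ring lra zify.

Set Implicit Arguments.
Unset Strict Implicit.
Unset Printing Implicit Defensive.

Import Order.TTheory GRing.Theory Num.Theory.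
Import numFieldNormedType.Exports.

Local Open Scope classical_set_scope.
Local Open Scope ring_scope.

Local Notation comp p := (connected_component (~` [set p])).

(** * Components of the complement of a point *)

Section punctured_components.
Context {R : realType} (T : metricType R).
Hypothesis Tconn : connected [set: T].
Hypothesis Tloc : locally_connected T.
Implicit Types (p q a b x y : T) (U E : set T).

Lemma open_connected_component U x : open U -> open (connected_component U x).
Proof.
move=> oU; rewrite openE => y xy.
have Uy : U y by exact: connected_component_sub xy.
have [V [oV cV Vy VU]] := Tloc (open_nbhs_nbhs (conj oU Uy)).
apply: (@filterS _ _ _ V); last exact: open_nbhs_nbhs.
rewrite (same_connected_component xy).
exact: connected_component_max.
Qed.

Lemma open_punctured p : open (~` [set p]).
Proof.
by apply: closed_openC; apply: accessible_closed_set1;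
  apply: hausdorff_accessible; exact: metric_hausdorff.
Qed.

Lemma open_comp p a : open (comp p a).
Proof. exact/open_connected_component/open_punctured. Qed.

Lemma compN p a : ~ comp p a p.
Proof. by move=> /connected_component_sub; exact. Qed.

Lemma comp_neq p a b : comp p a b -> b <> p.
Proof. by move=> pab bp; move: pab; rewrite bp; exact: compN. Qed.

Lemma comp_refl p a : a <> p -> comp p a a.
Proof. by move=> ap; exact: connected_component_refl. Qed.

Lemma connected_sub_comp p a b E : connected E -> ~ E p -> E a -> E b ->
  comp p a b.
Proof.
move=> cE Ep Ea Eb; exists E => //; split => //.
by move=> y Ey /= yp; apply: Ep; rewrite -yp.
Qed.

Lemma comp_sub_comp p a b q : comp p a b -> ~ comp p a q ->
  comp p a `<=` comp q b.
Proof.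
move=> pab paq y pay; apply: (connected_sub_comp _ paq) => //.
exact: component_connected.
Qed.

Lemma closure_comp p a : closure (comp p a) `<=` comp p a `|` [set p].
Proof.
move=> q clq; have [->|qp] := eqVneq q p; [by right|left].
have /clq[y [pay pqy]] : nbhs q (comp p q).
  by apply: open_nbhs_nbhs; split; [exact: open_comp|exact/comp_refl/eqP].
apply: connected_component_trans pay _; exact: connected_component_sym.
Qed.

(** Otherwise the component would be open and closed, hence all of the connected space, although it
    misses [p]. *)
Lemma closure_comp_center p a : a <> p -> closure (comp p a) p.
Proof.
move=> ap; apply: contrapT => clp.
have cC : closed (comp p a).
  apply/closure_id/seteqP; split; first exact: subset_closure.
  move=> y cly; have [//|yp] := closure_comp cly.
  by rewrite yp in cly.
suff /seteqP[_ /(_ p I)] : comp p a = [set: T] by exact: compN.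
apply: Tconn.
- by exists a; exact: comp_refl.
- by exists (comp p a); rewrite ?setTI//; exact: open_comp.
- by exists (comp p a); rewrite ?setTI.
Qed.

(** The closure of [comp p a] is connected, contains [a] and [p], and misses [q]. *)
Lemma comp_swap p a q : a <> p -> q <> p -> ~ comp p a q -> comp q a p.
Proof.
move=> ap qp paq.
apply: (@connected_sub_comp _ _ _ (closure (comp p a))).
- exact/connected_closure/component_connected.
- by move=> /closure_comp[].
- exact/subset_closure/comp_refl.
- exact: closure_comp_center.
Qed.

(** At a common point [z], [comp_swap] gives [comp q z p], which would put [p] into [comp q b]. *)
Lemma comp_disjoint p a q b : p <> q ->
  ~ comp p a q -> ~ comp q b p -> comp p a `&` comp q b `<=` set0.
Proof.
move=> pq paq qbp z [paz qbz]; apply: qbp.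
have zp := comp_neq paz.
apply: connected_component_trans qbz _.
apply: comp_swap => //; first by move/esym.
by rewrite -(same_connected_component paz).
Qed.

(* Zorn's lemma, applied to the order "q is p or p separates x from q": a
   maximal point of the component is a leaf. *)
Lemma comp_leaf x c : compact [set: T] -> c <> x ->
  exists2 l, leaves T l & comp x c l.
Proof.
move=> Tcpt cx.
pose S := {p : T | p \in comp x c}.
have SP (p : S) : comp x c (sval p) by apply: set_mem; exact: (valP p).
pose K p := ~` comp p x.
have KS p q : comp x c p -> K p q -> comp x c q.
  move=> xcp Kpq; apply: contrapT => xcq; apply: Kpq.
  have xp : x <> p by move/esym; exact: comp_neq xcp.
  have [->|/eqP qx] := eqVneq q x; first exact: comp_refl.
  apply: connected_component_sym; apply: comp_swap => //.
    by move/esym.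
  move=> xqp; apply: xcq; apply: connected_component_trans xcp _.
  exact: connected_component_sym.
have Kx p q : p <> x -> K p q -> comp p x `<=` comp q x.
  move=> px Kpq; apply: comp_sub_comp => //.
  by apply: comp_refl => xp; apply: px.
pose r (p q : S) := `[< K (sval p) (sval q) >].
have Sx (p : S) : sval p <> x by exact: comp_neq (SP p).
have rr (p : S) : r p p by apply/asboolP; exact: compN.
have rtrans (p q s : S) : r p q -> r q s -> r p s.
  move=> /asboolP pq /asboolP qs; apply/asboolP => ps; apply: qs.
  exact: (Kx _ _ (Sx p) pq).
have [||p pmax] := Zorn rr rtrans.
- move=> p q /asboolP pq /asboolP qp; apply: val_inj.
  apply: contrapT => pqN; apply: qp.
  apply: connected_component_sym.
  apply: (@connected_sub_comp _ _ _ (closure (comp (sval p) x))).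
  + exact/connected_closure/component_connected.
  + by move=> /closure_comp[//|/esym].
  + by apply: closure_comp_center => /esym; exact: Sx.
  + by apply/subset_closure/comp_refl => /esym; exact: Sx.
- move=> A Atot; have [[p0 Ap0]|A0] := pselect (A !=set0); last first.
    exists (exist _ c (mem_set (comp_refl cx))) => s As.
    by exfalso; apply: A0; exists s.
  have KK (p q : S) : r p q -> K (sval q) `<=` K (sval p).
    by move=> /asboolP pq; apply: subsetC; exact: (Kx _ _ (Sx p) pq).
  (* The closed sets [K p] for [p] in the totally ordered [A] generate a filter; by compactness it
     has a cluster point, which lies in all of them and so bounds [A] from above. *)
  pose F := filter_from A (fun p : S => K (sval p)).
  have FF : ProperFilter F.
    apply: filter_from_proper => [|p _]; last by exists (sval p); exact: compN.
    apply: filter_from_filter => [|p q Ap Aq]; first by exists p0.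
    have [pq|qp] := Atot _ _ Ap Aq.
      by exists q => // y Ky; split=> //; exact: KK Ky.
    by exists p => // y Ky; split=> //; exact: KK Ky.
  have [|z [_ clz]] := Tcpt F FF; first exact: filterT.
  have Az (p : S) : A p -> K (sval p) z.
    move=> Ap; have cK : closed (K (sval p)).
      by apply: open_closedC; exact: open_comp.
    by apply: cK => V; apply: clz; exists p.
  exists (exist _ z (mem_set (KS _ _ (SP p0) (Az _ Ap0)))) => s As.
  by apply/asboolP; exact: Az.
exists (sval p); last exact: SP.
rewrite /leaves /=; suff -> : ~` [set sval p] = comp (sval p) x.
  exact: component_connected.
apply/seteqP; split => [q qp|]; last exact: connected_component_sub.
(* Other than [p], a point outside [comp p x] would lie strictly above [p]. *)
apply: contrapT => Kpq.
have := pmax (exist _ q (mem_set (KS _ _ (SP p) Kpq))).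
move=> /(_ (asboolT Kpq)) /(congr1 sval) /= pq.
by apply: qp.
Qed.

End punctured_components.

(** * Shortening chains *)

Section shortest_chains.
Context {X : Type} (P : set X) (e : X -> X -> Prop) (u v : X).
Implicit Types (m : nat) (y : nat -> X).

Definition chain m y := [/\ forall i, (i <= m)%N -> P (y i),
  forall i, (i < m)%N -> e (y i) (y i.+1), y 0%N = u & y m = v].

(** The entries [i.+1] to [i + s] are dropped; a repeated value or a direct step bridges the gap.
    Only the direct step needs an entry after [i + s]. *)
Lemma chain_cut m y i s : chain m y -> (i + s <= m)%N ->
    y i = y (i + s)%N \/ (i + s < m)%N /\ e (y i) (y (i + s).+1) ->
  exists y', chain (m - s) y'.
Proof.
move=> [yP ye y0 ym] ism cut.
exists (fun k => if (k <= i)%N then y k else y (k + s)%N); split.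
- by move=> k kms; case: ifP => ki; apply: yP; lia.
- move=> k kms; case: (leqP k i) => ki; case: ifP => ki1; try lia.
  + by apply: ye; lia.
  + have -> : k = i by lia.
    case: cut => [->|[_]]; last by rewrite addSn.
    by rewrite addSn; apply: ye; lia.
  + by rewrite addSn; apply: ye; lia.
- by rewrite leq0n.
- case: ifP => msi; last by rewrite subnK//; lia.
  case: cut => [yi|[]]; last by lia.
  have -> : (m - s)%N = i by lia.
  by rewrite yi -ym; congr y; lia.
Qed.

(** Strong induction on the length: any repetition or shortcut allows a cut. *)
Lemma shortest_chain m y : chain m y -> exists m' y', [/\ chain m' y',
  forall i j, (i < j <= m')%N -> y' i <> y' j &
  forall i j, (i < j <= m')%N -> e (y' i) (y' j) -> j = i.+1].
Proof.
elim/ltn_ind: m y => m IH y ych.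
have cutP i s : (0 < s)%N -> (i + s <= m)%N ->
    y i = y (i + s)%N \/ (i + s < m)%N /\ e (y i) (y (i + s).+1) ->
    exists m' y', [/\ chain m' y',
    forall i j, (i < j <= m')%N -> y' i <> y' j &
    forall i j, (i < j <= m')%N -> e (y' i) (y' j) -> j = i.+1].
  move=> s0 ism /(chain_cut ych ism)[y' /IH]; apply.
  by rewrite ltn_subrL; lia.
have [[i [j [ij yij]]]|inj] :=
    pselect (exists i j, (i < j <= m)%N /\ y i = y j).
  by apply: (cutP i (j - i)%N); [lia..|left; rewrite subnKC//; lia].
have [[i [j [ij yij ji]]]|short] :=
    pselect (exists i j, [/\ (i < j <= m)%N, e (y i) (y j) & j <> i.+1]).
  apply: (cutP i (j - i.+1)%N); [lia..|right]; split; first lia.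
  by have -> : (i + (j - i.+1)).+1 = j by lia.
exists m, y; split=> // i j ij.
  by move=> yij; apply: inj; exists i, j.
by move=> yij; apply: contrapT => ji; apply: short; exists i, j.
Qed.

End shortest_chains.

(** * Separated points in doubling spaces *)

Section doubling.
Context {R : realType} (T : metricType R) (D : R).
Hypothesis Tdoubling : doubling T D.

Lemma doubling_exp n x r : 0 < r -> exists s : seq T,
  (size s)%:R <= D ^+ n /\
  cball x r `<=` \bigcup_(y in [set` s]) cball y (r / 2 ^+ n).
Proof.
have D0 : 0 <= D.
  by have [s [sD _]] := Tdoubling x ltr01; exact: le_trans sD.
elim: n => [|n IH] in x r * => r0.
  exists [:: x]; rewrite !expr0 divr1; split => // y xy; exists x => //=.
  by rewrite inE.
have [s [sD xs]] := IH x r r0.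
have r'0 : 0 < r / 2 ^+ n by rewrite divr_gt0// exprn_gt0.
have /choice[f fP] y := Tdoubling y r'0.
exists (flatten [seq f y | y <- s]); split.
  rewrite exprSr; apply: le_trans (_ : (size s)%:R * D <= _); last first.
    by rewrite ler_wpM2r.
  elim: (s) => [|y t IHt] /=; first by rewrite mul0r.
  rewrite size_cat natrD mulrS addrC mulrDl mul1r [leRHS]addrC lerD//.
  exact: (fP y).1.
move=> z /xs[y /= ys yz]; have [_ /(_ z yz)[w /= wf wz]] := fP y.
exists w; last by rewrite exprSr invfM mulrA.
by apply/flattenP; exists (f y) => //; exact: map_f.
Qed.

(** After [n] halvings a covering ball has diameter less than [h], so it contains at most one
    [z i]. *)
Lemma doubling_separated n N (z : 'I_N -> T) x r h : 0 < r ->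
    (forall i, mdist x (z i) <= r) ->
    (forall i j, i != j -> h <= mdist (z i) (z j)) ->
  2 * (r / 2 ^+ n) < h -> N%:R <= D ^+ n.
Proof.
move=> r0 zr zh rh; have [s [sD xs]] := doubling_exp n x r0.
apply: le_trans sD; rewrite ler_nat.
have /choice[f fP] i : exists y, y \in s /\ mdist y (z i) <= r / 2 ^+ n.
  by have [y ys yz] := xs _ (zr i); exists y.
suff finj : injective f.
  rewrite -[N]size_enum_ord -(size_map f).
  apply: uniq_leq_size; first by rewrite map_inj_uniq// enum_uniq.
  by move=> _ /mapP[i _ ->]; exact: (fP i).1.
move=> i j fij; apply/eqP; apply: contraTT rh => /zh hz; rewrite -leNgt.
apply: (le_trans hz); apply: (le_trans (metric_triangle _ (f i) _)).
rewrite mulrDl mul1r metric_sym lerD//; first exact: (fP i).2.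
by rewrite fij; exact: (fP j).2.
Qed.

End doubling.

(** * Size and separation properties of the components at a point *)

Section tentacles.
Context {R : realType} (T : metricType R).
Hypothesis Tcpt : compact [set: T].
Hypothesis Tconn : connected [set: T].
Hypothesis Tloc : locally_connected T.
Implicit Types (p q a b c z : T) (h : R).

(** Of three distinct components, at most two contain [a] or [b]. *)
Lemma branch_point_comp p a b : branch_points T p ->
  exists c, [/\ c <> p, ~ comp p c a & ~ comp p c b].
Proof.
move=> /pcard_leP/injfunPex[f fC finj].
have f_neq i j : (i < j < 3)%N -> f i <> f j.
  move=> ij fij.
  suff : i = j by lia.
  by apply: finj => //; apply/mem_set => /=; lia.
have [i i3 [ia ib]] : exists2 i, (i < 3)%N &
    f i <> comp p a /\ f i <> comp p b.
  apply: contrapT => nex.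
  have fab i : (i < 3)%N -> f i = comp p a \/ f i = comp p b.
    move=> i3; apply: contrapT => /not_orP ?; by apply: nex; exists i.
  have := f_neq 0%N 1%N isT; have := f_neq 0%N 2%N isT.
  have := f_neq 1%N 2%N isT.
  have := fab 0%N isT; have := fab 1%N isT; have := fab 2%N isT.
  by move=> [->|->] [->|->] [->|->].
have [c cp fc] := fC i i3.
by exists c; split => // /same_connected_component; rewrite fc.
Qed.

Lemma mdist_continuous p : continuous (mdist p : T -> R).
Proof.
move=> x; apply/cvgrPdist_lt => e e0; apply/nbhs_ballP; exists e => //= y.
rewrite ballEmdist /= => xye; apply: le_lt_trans xye.
have := metric_triangle p x y; have := metric_triangle p y x.
by rewrite (metric_sym y x) ler_norml => ? ?; apply/andP; split; lra.
Qed.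

(** Intermediate values of the distance from [p] on the connected closure of the component, which
    contains both [p] and a leaf. *)
Lemma comp_dist_ivt p c h : c <> p -> 0 < h ->
    (forall l, leaves T l -> h <= mdist p l) ->
  exists2 z, comp p c z & mdist p z = h.
Proof.
move=> cp h0 hl; have [l Ll pcl] := comp_leaf Tconn Tloc Tcpt cp.
have : is_interval (mdist p @` closure (comp p c)).
  apply/connected_intervalP; apply: connected_continuous_connected.
    exact/connected_closure/component_connected.
  exact/continuous_subspaceT/mdist_continuous.
move=> /(_ 0 (mdist p l)) itv.
have [|||z clz pz] := itv _ _ h.
- by exists p; [exact: closure_comp_center|exact: mdistxx].
- by exists l => //; exact: subset_closure.
- by rewrite ltW//= hl.
exists z => //; have [//|zp] := closure_comp Tloc clz.
by move: h0; rewrite -pz zp mdistxx ltxx.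
Qed.

Hypothesis Tturn : bounded_turning T 1.

(** Every connected set joining [a] to [b] passes through [p], and with turning constant 1 one of
    them has diameter at most [mdist a b]. *)
Lemma comp_turn p c a b : comp p c a -> ~ comp p c b ->
  mdist a p <= mdist a b /\ mdist b p <= mdist a b.
Proof.
move=> pca pcb; have [E [_ Econn Ea Eb]] := Tturn a b.
rewrite mul1r => diamE.
have Ep : E p.
  apply: contrapT => Ep; apply: pcb; apply: connected_component_trans pca _.
  exact: connected_sub_comp Ea Eb.
have le_diam x y : E x -> E y -> mdist x y <= mdist a b.
  move=> Ex Ey; rewrite -lee_fin; apply: le_trans diamE.
  by apply: ereal_sup_ubound; exists x => //; exists y.
by split; exact: le_diam.
Qed.

End tentacles.

(** * Chains of branch points away from the leaves *)

Section branch_point_chains.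
Context {R : realType} (T : metricType R) (D : R).
Hypothesis Tcpt : compact [set: T].
Hypothesis Tconn : connected [set: T].
Hypothesis Tloc : locally_connected T.
Hypothesis Tturn : bounded_turning T 1.
Hypothesis Tdoubling : doubling T D.
Implicit Types (m : nat) (y : nat -> T) (h eps r : R).

Lemma last_before (Q : nat -> Prop) j m : (j <= m)%N -> Q j -> ~ Q m ->
  exists a, [/\ (j <= a < m)%N, Q a & ~ Q a.+1].
Proof.
elim: m => [|m IH] jm Qj Qm.
  by exfalso; apply: Qm; move: jm; rewrite leqn0 => /eqP <-.
have [Qm'|Qm'] := pselect (Q m).
  exists m; split => //; rewrite ltnSn andbT.
  by move: jm; rewrite leq_eqVlt => /predU1P[jm|//]; rewrite -jm in Qm.
have jm' : (j <= m)%N.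
  by move: jm; rewrite leq_eqVlt => /predU1P[jm|//]; rewrite -jm in Qm.
have [a [/andP[ja am] Qa Qa1]] := IH jm' Qj Qm'.
by exists a; split => //; rewrite ja ltnS ltnW.
Qed.

(* An eps-step into or out of a component of the complement of y i passes
   through y i, hence can be replaced by a step ending or starting at y i. *)
Lemma shortest_chain_avoids_comp m y c eps i j :
    (forall k, (k < m)%N -> mdist (y k) (y k.+1) <= eps) ->
    (forall k l, (k < l <= m)%N -> mdist (y k) (y l) <= eps -> l = k.+1) ->
    (i <= m)%N -> (j <= m)%N ->
    ~ comp (y i) c (y 0%N) -> ~ comp (y i) c (y m) -> ~ comp (y i) c (y j).
Proof.
move=> ye short im jm y0 ym yj; have [ij|ji|ij] := ltngtP i j.
- have [a [/andP[ja am] Qa Qa1]] :=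
    @last_before (fun k => comp (y i) c (y k)) j m jm yj ym.
  have [_ ai] := comp_turn Tturn Qa Qa1.
  suff : a.+1 = i.+1 by lia.
  apply: short; first lia.
  by rewrite metric_sym (le_trans ai)// ye.
- have [a [/andP[_ aj] Qa Qa1]] :=
    @last_before (fun k => ~ comp (y i) c (y k)) 0 j (leq0n j) y0 (@^~ yj).
  have [_ ai] := comp_turn Tturn (contrapT Qa1) Qa.
  suff : i = a.+1 by lia.
  apply: short; first lia.
  by rewrite (le_trans ai)// metric_sym ye//; lia.
- by move: yj; rewrite -ij; exact: compN.
Qed.

Lemma chain_dist m y eps :
    (forall k, (k < m)%N -> mdist (y k) (y k.+1) <= eps) ->
  mdist (y 0%N) (y m) <= m%:R * eps.
Proof.
elim: m => [|m IH] ye; first by rewrite mdistxx mul0r.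
apply: le_trans (metric_triangle _ (y m) _) _.
rewrite mulrSr mulrDl mul1r lerD ?ye ?IH// => k km.
by rewrite ye// ltnW.
Qed.

(** Doubling bounds the number of points of the shortened chain by [D ^+ 3]. A chain of [n] steps
    has [n.+1] points, which leaves room for the extra [eps] on the left. *)
Lemma branch_point_chain m y h eps : 0 < h -> 0 <= eps ->
    (forall i, (i <= m)%N -> [/\ branch_points T (y i),
      forall l, leaves T l -> h <= mdist (y i) l & mdist (y 0%N) (y i) <= h]) ->
    (forall i, (i < m)%N -> mdist (y i) (y i.+1) <= eps) ->
  mdist (y 0%N) (y m) + eps <= D ^+ 3 * eps.
Proof.
move=> h0 eps0 yP ye.
(* [P] records the properties that the shortened chain must inherit. *)
pose P := [set p | [/\ branch_points T p,
  forall l, leaves T l -> h <= mdist p l & mdist (y 0%N) p <= h]].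
pose e (p q : T) : Prop := mdist p q <= eps.
have ych : chain P e (y 0%N) (y m) m y by split.
have {ych}[n [x [[xP xe x0 xn] xinj short]]] := shortest_chain ych.
rewrite -xn -x0.
have /choice[c cP] i : exists c, (i <= n)%N ->
    [/\ c <> x i, ~ comp (x i) c (x 0%N) & ~ comp (x i) c (x n)].
  have [ni|/xP[Bi _ _]] := ltnP n i; first by exists (x i).
  by have [c cP] := branch_point_comp (x 0%N) (x n) Bi; exists c.
have avoid i j : (i <= n)%N -> (j <= n)%N -> ~ comp (x i) (c i) (x j).
  move=> ni nj; have [_ c0 cn] := cP i ni.
  exact: shortest_chain_avoids_comp xe short ni nj c0 cn.
have /choice[z zP] (i : 'I_n.+1) : exists z,
    comp (x i) (c i) z /\ mdist (x i) z = h.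
  have ni : (i <= n)%N by rewrite -ltnS.
  have [ci _ _] := cP i ni; have [_ hi _] := xP i ni.
  have [z iz xz] := comp_dist_ivt Tcpt Tconn Tloc ci h0 hi.
  by exists z.
(* The [z i] lie within [h + h] of [x 0]; three halvings give radius [h / 4], and
   [2 * (h / 4) < h]. *)
have nD : n.+1%:R <= D ^+ 3.
  apply: (doubling_separated Tdoubling (z := z) (x := x 0%N) (r := 2 * h)
    (h := h)).
  - by rewrite mulr_gt0.
  - move=> i; have [_ _ x0i] := xP i (ltn_ord i).
    apply: le_trans (metric_triangle _ (x i) _) _.
    by rewrite (zP i).2 x0; lra.
  - move=> i j ij; have [iz xz] := zP i; have [jz _] := zP j.
    have xij : x i <> x j.
      wlog ltij : i j ij {iz xz jz} / (i < j)%N.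
        move=> H; move: (ij); rewrite neq_ltn => /orP[|ltji]; first exact: H.
        by apply/nesym/H => //; rewrite eq_sym.
      by apply: xinj; rewrite ltij -ltnS ltn_ord.
    (* Disjointness makes [x i] separate [z i] from [z j], so their distance is at least
       [mdist (x i) (z i) = h]. *)
    have ij0 := comp_disjoint Tconn Tloc xij (avoid i j (ltn_ord i) (ltn_ord j))
      (avoid j i (ltn_ord j) (ltn_ord i)).
    have [+ _] := comp_turn Tturn iz (fun izj => ij0 _ (conj izj jz)).
    by rewrite metric_sym xz.
  - lra.
apply: le_trans (ler_wpM2r eps0 nD).
by rewrite mulrSr mulrDl mul1r lerD2r chain_dist.
Qed.

End branch_point_chains.

(** * The quotient distance and chains in the quotient *)

Section quotient_distance.
Context {R : realType} (T : metricType R) (E : set T).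
Implicit Types (x y : T) (h : R).

Lemma dist_set_quotient_dist x y :
  (dist_set E x <= (quotient_dist E x y)%:E + dist_set E y)%E.
Proof.
rewrite quotient_distE; have [_|_] := leP (mdist x y)%:E;
  first exact: dist_set_triangle.
by rewrite -addeA leeDl// adde_ge0 ?dist_set_ge0.
Qed.

(** The detour through [E] costs at least [h + h], so the minimum is the direct distance. *)
Lemma mdist_quotient_dist x y h : (h%:E <= dist_set E x)%E ->
  (h%:E <= dist_set E y)%E -> quotient_dist E x y < h + h ->
  mdist x y = quotient_dist E x y.
Proof.
move=> hx hy; rewrite -lte_fin quotient_distE => xyh.
apply: EFin_inj; rewrite quotient_distE; move: xyh.
by have [//|_] := leP (mdist x y)%:E; rewrite ltNge EFinD leeD.
Qed.

Lemma dist_set_le x e : E e -> (dist_set E x <= (mdist x e)%:E)%E.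
Proof. by move=> Ee; apply: ereal_inf_lbound; exists e. Qed.

End quotient_distance.

(** Stated for representatives in [T] and for the initial end only, so that it can be applied to a
    chain and to its reversal. *)
Lemma no_chain_away_from_leaves (R : realType) (T : metricType R) (D : R) m
    (y : nat -> T) (r : R) (E := closure (leaves T)) :
    compact [set: T] -> connected [set: T] -> locally_connected T ->
    bounded_turning T 1 -> doubling T D -> 1 <= D ->
    0 < r -> r <= quotient_dist E (y 0%N) (y m) ->
    (forall i, (i <= m)%N -> (branch_points T `|` E) (y i)) ->
    (forall i, (i < m)%N ->
      quotient_dist E (y i) (y i.+1) <= 1 / (8 * D ^+ 3) * r) ->
  ~ ((r / 2)%:E <= dist_set E (y 0%N))%E.
Proof.
move=> Tcpt Tconn Tloc Tturn Tdoubling D1 r0 ry yBE ye y0E.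
set eps := _ * r in ye.
have D3 : 1 <= D ^+ 3 by rewrite exprn_ege1.
have D3eps : D ^+ 3 * eps = r / 8.
  by rewrite /eps; field; rewrite gt_eqF// (lt_le_trans ltr01).
have eps0 : 0 < eps.
  by rewrite mulr_gt0// divr_gt0// mulr_gt0// (lt_le_trans ltr01).
have epsr : eps <= r / 8 by rewrite -D3eps ler_peMl// ltW.
(* The first index beyond quotient distance [r / 4] from the start will be [k.+1]. *)
have exk : exists k, (k <= m)%N && (r / 4 < quotient_dist E (y 0%N) (y k)).
  by exists m; rewrite leqnn/=; lra.
case: (ex_minnP exk) => -[|k] /andP[km yk] kmin.
  by move: yk; rewrite quotient_distxx; lra.
have y0i i : (i <= k)%N -> quotient_dist E (y 0%N) (y i) <= r / 4.
  move=> ik; rewrite leNgt; apply/negP => yi.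
  have im : (i <= m)%N by lia.
  suff : (k < i)%N by rewrite ltnNge ik.
  by apply: kmin; rewrite im yi.
have yiE i : (i <= k)%N -> ((r / 4)%:E <= dist_set E (y i))%E.
  move=> ik; have := dist_set_quotient_dist E (y 0%N) (y i).
  move=> /(le_trans y0E); have := y0i i ik; have := dist_set_ge0 E (y i).
  case: (dist_set E (y i)) => [a| |]//; last by move=> *; rewrite leey.
  by rewrite -EFinD !lee_fin; lra.
have y0iE i : (i <= k)%N -> mdist (y 0%N) (y i) = quotient_dist E (y 0%N) (y i).
  move=> ik; apply: (@mdist_quotient_dist _ _ _ _ _ (r / 4)); rewrite ?yiE//.
  by have := y0i i ik; lra.
have ykeps : quotient_dist E (y 0%N) (y k) + eps <= r / 8.
  rewrite -y0iE// -D3eps.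
  apply: (branch_point_chain Tcpt Tconn Tloc Tturn Tdoubling (h := r / 4)).
  - by lra.
  - exact: ltW.
  - move=> i ik; split; last by rewrite y0iE// y0i.
      (* A point of [E] would be at distance 0 from [E], not at least [r / 4]. *)
      have [//|/dist_set_in Ei] := yBE i (leq_trans ik (ltnW km)).
      by have := yiE i ik; rewrite Ei lee_fin; lra.
    move=> l Ll; rewrite -lee_fin; apply: le_trans (yiE i ik) _.
    exact/dist_set_le/subset_closure.
  (* Steps are at most [r / 8], below twice [r / 4], so they have the same length in [T]. *)
  - move=> i ik; have yi := ye i (ltn_trans ik km).
    rewrite (@mdist_quotient_dist _ _ E _ _ (r / 4))//.
    + by apply: yiE; exact: ltnW.
    + exact: yiE.
    + by lra.
(* The next step reaches at most [r / 8], short of the [r / 4] exceeded at [k.+1]. *)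
have := quotient_dist_triangle E (y k) (y 0%N) (y k.+1).
by have := ye k km; lra.
Qed.

Theorem theorem4p17 (R : realType) (T : metricType R) (D : R)
    (hT : quasiconformal_tree T 1 D) :
  let B := branch_points T in
  let L := leaves T in
  uniformly_disconnected (1 / (8 * D ^+ 3))
    (quotient_class (@closed_closure T L) @` (B `|` closure L)).
Proof.
case: hT => -[Tcpt Tconn Tloc _] Tturn Tdoubling B L [m [x [xA x0m xch]]].
have /choice[y yP] i : exists y, (i <= m)%N ->
    (B `|` closure L) y /\ quotient_class (@closed_closure T L) y = x i.
  have [im|mi] := leqP i m; last by have [y] := xA 0%N (leq0n m); exists y.
  by have [y yBL yx] := xA i im; exists y.
have xy i j : (i <= m)%N -> (j <= m)%N ->
    mdist (x i) (x j) = quotient_dist (closure L) (y i) (y j).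
  by move=> im jm; rewrite -(yP i im).2 -(yP j jm).2 mdist_quotient_class.
have yBL i im := (yP i im).1.
have ye i : (i < m)%N -> quotient_dist (closure L) (y i) (y i.+1) <=
    1 / (8 * D ^+ 3) * quotient_dist (closure L) (y 0%N) (y m).
  by move=> im; rewrite -!xy ?xch// ltnW.
have r0 : 0 < quotient_dist (closure L) (y 0%N) (y m).
  by rewrite -xy// mdist_gt0; exact/eqP.
have D1 : 1 <= D.
  have [s [sD ys]] := Tdoubling (y 0%N) 1 ltr01.
  apply: le_trans sD; rewrite ler1n lt0n size_eq0; apply/eqP => s0.
  have [|z] := ys (y 0%N); first by rewrite /cball/= mdistxx.
  by rewrite s0.
have N0 := no_chain_away_from_leaves Tcpt Tconn Tloc Tturn Tdoubling D1 r0
  (lexx _) yBL ye.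
(* The reversed chain handles the other end. *)
pose y' i := y (m - i)%N.
have [] // := @no_chain_away_from_leaves R T D m y' _ Tcpt Tconn Tloc Tturn
  Tdoubling D1 r0.
- by rewrite /y' subn0 subnn quotient_dist_sym.
- by move=> i im; apply: yBL; exact: leq_subr.
- move=> i im; rewrite /y' quotient_dist_sym.
  by have -> : (m - i = (m - i.+1).+1)%N; [lia|apply: ye; lia].
rewrite /y' subn0.
(* If both ends were closer to the closure of the leaves than half their quotient distance, the
   detour through it would be too short. *)
rewrite leNgt; apply/negP => ymE; apply: N0; rewrite leNgt; apply/negP => y0E.
have := lteD y0E ymE; rewrite -EFinD -splitr ltNge quotient_distE.
by rewrite ge_min lexx orbT.
Qed.
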